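(* Let $f:\mathbb R^n\to\mathbb R$ be locally Lipschitz, $C\subset\mathbb R^n$ closed convex, $\mathscr O$ a cutting plane oracle for $f$, and consider the inner loop (described in the context) at $x\in C$ with matrix $Q\succ0$, modified by the fall-back rule: whenever $z^k$ fails the acceptance test with $\widetilde\rho_k<\widetilde\gamma$, one falls back on $y^k$ as trial step. Suppose this inner loop at $x$ turns infinitely (no trial step is ever accepted). Then $0\in\partial f(x)+N_C(x)$.
   Context: $\partial f$ is the Clarke subdifferential, $N_C$ the normal cone, $i_C$ the indicator function of $C$. $\|\cdot\|$ is a fixed norm on $\mathbb R^n$ (the trust-region norm), $B(x,r)$ the closed $\|\cdot\|$-ball. Cutting plane oracle. Fix $M>0$. A cutting plane oracle for $f$ is a set-valued operator $\mathscr O$ on $\mathbb R^n\times\mathbb R^n$ with values nonempty bounded subsets of $\mathbb R\times\mathbb R^n$, bounded on bounded sets; $(a,g)\in\mathscr O(z,x)$ represents the affine function $a+g^{\mathsf T}(\cdot-x)$. It satisfies: $(\mathscr O_1)$ if $(a,g)\in\mathscr O(z,x)$, then $a\le f(x)$; moreover $\mathscr O(x,x)$ contains at least one element $(f(x),g)$ with $g\in\partial f(x)$; $(\mathscr O_2)$ if $(a_j,g_j)\in\mathscr O(z_j,x)$, $a_j\to f(x)$, $\|z_j-x\|\le M$, $g_j\to g$, then $g\in\partial f(x)$; $(\mathscr O_3)$ if $z_j\to x$, there exist $(a_j,g_j)\in\mathscr O(z_j,x)$ and $\epsilon_j\to0^+$ with $f(z_j)\le a_j+g_j^{\mathsf T}(z_j-x)+\epsilon_j\|z_j-x\|$;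 $(\mathscr O_4)$ if $z_j\to z$, $y_j\to y$, $x_j\to x$ with $\|z_j-x_j\|\le M$, and $(a_j,g_j)\in\mathscr O(z_j,x_j)$, then there exist $z'\in B(x,M)$ and $(a',g')\in\mathscr O(z',x)$ with $\limsup_j\,a_j+g_j^{\mathsf T}(y_j-x_j)\le a'+g'^{\mathsf T}(y-x)$. $M$ is understood to be large enough that all points $z$ at which the oracle is called in the inner loop at $x$ satisfy $\|z-x\|\le M$. Inner loop at $x\in C$ with symmetric $Q\succeq0$, $\|Q\|\le q$. Parameters $0<\gamma<\widetilde\gamma<1$, $0<\theta\ll1$, $\Theta\ge1$, $q>0$; initial radius $R_1>0$; $k=1$. At counter $k$ there is a first-order working model $\phi_k(\cdot,x)=\sup\{a+g^{\mathsf T}(\cdot-x):(a,g)\in\mathscr W_k\}$ and a second-order working model $\Phi_k(\cdot,x)=\phi_k(\cdot,x)+\frac12(\cdot-x)^{\mathsf T}Q(\cdot-x)$. $\mathscr W_1$ consists of oracle planes $(a,g)\in\mathscr O(z,x)$ and contains at least one exactness plane, i.e. some $(f(x),g)\in\mathscr O(x,x)$. (Trial step) Compute a solution $y^k$ of the tangent program: minimize $\Phi_k(y,x)$ subject to $y\in C$, $\|y-x\|\le R_k$. By optimality there is an aggregate subgradient $g_k^*\in\partial(\phi_k(\cdot,x)+i_C)(y^k)$ with $g_k^*+Q(y^k-x)+v_k=0$, $v_k$ in the normal cone to $B(x,R_k)$ at $y^k$; the aggregate plane is $m_k^*(\cdot,x)=\phi_k(y^k,x)+g_k^{*\mathsf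 T}(\cdot-y^k)$. A trial step is any $z^k\in C$ with $f(x)-\Phi_k(z^k,x)\ge\theta(f(x)-\Phi_k(y^k,x))$ and $\|z^k-x\|\le\Theta\|y^k-x\|$ (the choice $z^k=y^k$ is always allowed). (Acceptance) If $\rho_k=\frac{f(x)-f(z^k)}{f(x)-\Phi_k(z^k,x)}\ge\gamma$, then $z^k$ is accepted as new serious iterate and the inner loop ends. (Null step) Otherwise form $\mathscr W_{k+1}$ so that it contains at least one exactness plane $(f(x),g)\in\mathscr O(x,x)$, the aggregate plane $m_k^*$, and all of $\mathscr O(z^k,x)$; any further elements must belong to $\mathscr W_k$ (elements of $\mathscr W_k$ may be dropped). Compute $\widetilde\rho_k=\frac{f(x)-\phi_{k+1}(z^k,x)}{f(x)-\Phi_k(z^k,x)}$, put $R_{k+1}=R_k$ if $\widetilde\rho_k<\widetilde\gamma$, $R_{k+1}=\frac12R_k$ if $\widetilde\rho_k\ge\widetilde\gamma$, and increase $k$. Fall-back rule. At counter $k$ first use $z^k$. If $z^k$ is not accepted, include the cutting planes at $z^k$ and compute $\widetilde\rho_k$ for $z^k$. If $\widetilde\rho_k\ge\widetilde\gamma$, put $R_{k+1}=\frac12R_k$, keep the set $\mathscr W_{k+1}$ formed by the null step rule with $z^k$ (containing an exactness plane, the aggregate plane $m_k^*$ and all of $\mathscr O(z^k,x)$), increase $k$, and compute the next trial step from the tangent program with the new working model and radius. If $\widetilde\rho_k<\widetilde\gamma$ (no reduction of $R_k$), forget about $z^k$ and use $y^k$ as the trial step in its place: apply the acceptance test to $y^k$,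 and if $y^k$ is not accepted, build $\mathscr W_{k+1}$ and determine $R_{k+1}$ by the null step rule with $z^k$ replaced by $y^k$. *)

(* Defs.v *)
From HB Require Import structures.
From mathcomp Require Import all_boot all_order all_algebra.
From mathcomp Require Import all_classical all_reals all_analysis.
Import Order.TTheory GRing.Theory Num.Theory.
Import numFieldNormedType.Exports.

Set Implicit Arguments.
Unset Strict Implicit.
Unset Printing Implicit Defensive.

Local Open Scope classical_set_scope.
Local Open Scope ring_scope.

Section Convex.
Context {R : realType} {n : nat}.
Local Notation V := 'cV[R]_n.

Definition dot (u v : V) : R := (u^T *m v) 0 0.

(* Topological notions on R^n are those of the library (sup norm); an
   arbitrary norm is a function N satisfying the axioms. *)
Record is_norm (N : V -> R) : Prop := IsNorm {
  is_normD : forall u v, N (u + v) <= N u + N v ;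
  is_normZ : forall (a : R) u, N (a *: u) = `|a| * N u ;
  is_norm0_eq0 : forall u, N u = 0 -> u = 0 }.

Definition cball (N : V -> R) (c : V) (r : R) : set V :=
  [set u | N (u - c) <= r].

(* operator norm induced by N *)
Definition opnorm (N : V -> R) (A : 'M[R]_n) : R :=
  sup [set N (A *m u) | u in [set u : V | N u <= 1]].

Definition symmetric_mx (A : 'M[R]_n) : Prop := A^T = A.

Definition posdef_mx (A : 'M[R]_n) : Prop :=
  forall u : V, u != 0 -> 0 < dot u (A *m u).

Definition indic_fun (C : set V) (u : V) : \bar R :=
  if u \in C then 0%E else +oo%E.

Definition normal_cone (C : set V) (c : V) : set V :=
  [set v | C c /\ forall u, C u -> dot v (u - c) <= 0].

(* Subdifferential of an extended-valued convex function, with which the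
   Clarke subdifferential agrees for lower semicontinuous convex functions. *)
Definition convex_subdiff (h : V -> \bar R) (c : V) : set V :=
  [set s | h c \is a fin_num /\
           forall u, (h c + (dot s (u - c))%:E <= h u)%E].

Definition locally_lipschitz (f : V -> R) : Prop :=
  forall u : V, lipschitz_on f (nbhs (u, u)).

Definition clarke_derivative (f : V -> R) (c d : V) : \bar R :=
  limf_esup (fun p : V * R => ((f (p.1 + p.2 *: d) - f p.1) / p.2)%:E)
            (filter_prod (nbhs c) (0 : R)^'+).

Definition clarke_subdiff (f : V -> R) (c : V) : set V :=
  [set s | forall d, ((dot s d)%:E <= clarke_derivative f c d)%E].

End Convex.

(* A pair (a, g) : R * 'cV[R]_n stands for the affine function
   a + g^T (. - x), where x is the point at which the inner loop works. *)
Section Oracle.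
Context {R : realType} {n : nat}.
Local Notation V := 'cV[R]_n.

Definition plane_eval (x : V) (p : R * V) (u : V) : R := p.1 + dot p.2 (u - x).

Record cutting_plane_oracle (N : V -> R) (M : R) (f : V -> R)
    (O : V -> V -> set (R * V)) : Prop := CuttingPlaneOracle {
  oracle_nonempty : forall z x, O z x !=set0 ;
  oracle_bounded : forall z x, bounded_set (O z x) ;
  oracle_bounded_on_bounded : forall B : set (V * V), bounded_set B ->
    bounded_set (\bigcup_(zx in B) O zx.1 zx.2) ;
  oracle_O1_minor : forall z x a g, O z x (a, g) -> a <= f x ;
  oracle_O1_exact : forall x, exists2 g, O x x (f x, g) & clarke_subdiff f x g ;
  oracle_O2 : forall (x : V) (z_ : nat -> V) (a_ : nat -> R) (g_ : nat -> V)
      (g : V),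
    (forall j, O (z_ j) x (a_ j, g_ j)) ->
    a_ @ \oo --> f x ->
    (forall j, N (z_ j - x) <= M) ->
    g_ @ \oo --> g ->
    clarke_subdiff f x g ;
  oracle_O3 : forall (x : V) (z_ : nat -> V), z_ @ \oo --> x ->
    exists (a_ : nat -> R) (g_ : nat -> V) (eps_ : nat -> R),
      [/\ forall j, O (z_ j) x (a_ j, g_ j),
          forall j, 0 < eps_ j,
          eps_ @ \oo --> (0 : R) &
          forall j, f (z_ j) <=
            a_ j + dot (g_ j) (z_ j - x) + eps_ j * N (z_ j - x)] ;
  oracle_O4 : forall (z y x : V) (z_ y_ x_ : nat -> V) (a_ : nat -> R)
      (g_ : nat -> V),
    z_ @ \oo --> z -> y_ @ \oo --> y -> x_ @ \oo --> x ->
    (forall j, N (z_ j - x_ j) <= M) ->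
    (forall j, O (z_ j) (x_ j) (a_ j, g_ j)) ->
    exists z' a' g',
      [/\ cball N x M z', O z' x (a', g') &
          (limn_esup (fun j => (a_ j + dot (g_ j) (y_ j - x_ j))%:E)
             <= (a' + dot g' (y - x))%:E)%E] }.

End Oracle.

Section InnerLoop.
Context {R : realType} {n : nat}.
Local Notation V := 'cV[R]_n.
Local Notation plane := (R * V)%type.

Variables (N : V -> R) (M : R) (f : V -> R) (C : set V)
  (O : V -> V -> set plane) (gamma gammat theta bigTheta : R)
  (x : V) (Q : 'M[R]_n).

(* The working sets occurring in a run are nonempty and bounded, so this
   supremum is never the default value of sup. *)
Definition model1 (W : set plane) (u : V) : R :=
  sup [set plane_eval x p u | p in W].

Definition model2 (W : set plane) (u : V) : R :=
  model1 W u + 2^-1 * dot (u - x) (Q *m (u - x)).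

Definition exactness_planes : set plane := [set p | O x x p /\ p.1 = f x].

Definition tangent_solution (W : set plane) (r : R) (y : V) : Prop :=
  (C `&` cball N x r) y /\
  forall u, (C `&` cball N x r) u -> model2 W y <= model2 W u.

Definition aggregate_subgradient (W : set plane) (r : R) (y g : V) : Prop :=
  convex_subdiff (fun u => ((model1 W u)%:E + indic_fun C u)%E) y g /\
  exists2 v, normal_cone (cball N x r) y v & g + Q *m (y - x) + v = 0.

(* u |-> model1 W y + g^T (u - y), rewritten with base point x *)
Definition aggregate_plane (W : set plane) (y g : V) : plane :=
  (model1 W y + dot g (x - y), g).

Definition trial_step (W : set plane) (y z : V) : Prop :=
  [/\ C z,
      theta * (f x - model2 W y) <= f x - model2 W z &
      N (z - x) <= bigTheta * N (y - x)].

(* If the denominator of rho or rhot vanishes the quotient is 0, and so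
   counts as a failed test. *)
Definition rho (W : set plane) (t : V) : R :=
  (f x - f t) / (f x - model2 W t).

Definition rhot (W W' : set plane) (t : V) : R :=
  (f x - model1 W' t) / (f x - model2 W t).

(* W' may be formed from W at a null step with trial step t *)
Definition null_step_set (W : set plane) (y g t : V) (W' : set plane) : Prop :=
  [/\ W' `&` exactness_planes !=set0,
      W' (aggregate_plane W y g),
      O t x `<=` W' &
      W' `<=` W `|` exactness_planes `|` [set aggregate_plane W y g]
                `|` O t x].

Definition next_radius (r rt : R) : R := if rt < gammat then r else r / 2.

(* One turn of the loop with the fall-back rule, from (W, r) to (W', r'), in
   which no trial step is accepted. The oracle is called at z, and at y only
   when falling back; M is large enough for these calls. Wz is the working set
   formed with z, which is forgotten when falling back on y. *)
Definition rejected_turn (W : set plane) (r : R) (y g z : V)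
    (W' : set plane) (r' : R) : Prop :=
  [/\ tangent_solution W r y,
      aggregate_subgradient W r y g,
      trial_step W y z,
      rho W z < gamma /\ N (z - x) <= M &
      exists2 Wz, null_step_set W y g z Wz &
        [/\ gammat <= rhot W Wz z, W' = Wz & r' = r / 2] \/
        [/\ rhot W Wz z < gammat,
            rho W y < gamma,
            N (y - x) <= M,
            null_step_set W y g y W' &
            r' = next_radius r (rhot W W' y)]].

(* Index k below is the counter value k + 1 of the algorithm. *)
Record infinite_inner_loop (W : nat -> set plane) (r : nat -> R)
    (y g z : nat -> V) : Prop := InfiniteInnerLoop {
  loop_init_radius : 0 < r 0%N ;
  loop_init_planes : forall p, W 0%N p ->
    exists2 z0, N (z0 - x) <= M & O z0 x p ;
  loop_init_exact : W 0%N `&` exactness_planes !=set0 ;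
  loop_turn : forall k,
    rejected_turn (W k) (r k) (y k) (g k) (z k) (W k.+1) (r k.+1) }.

End InnerLoop.

(* Main.v *)
Require Import Defs.
From mathcomp Require Import all_boot all_order all_algebra.
From mathcomp Require Import all_classical all_reals all_analysis.
From mathcomp Require Import ring lra.
Import Order.TTheory GRing.Theory Num.Theory.
Import numFieldNormedType.Exports.
Local Open Scope classical_set_scope.
Local Open Scope ring_scope.
Set Implicit Arguments.
Unset Strict Implicit.

(* On [C] every first-order working model lies below the envelope [phi], the
   supremum of the oracle planes called within distance [M] of [x]: aggregate
   planes inherit this bound because they only support [phi_k + i_C]. So it is
   enough to find [k] and arbitrarily small [r' <= R_k] with
   [f x - Phi_k (y_k) = o(r')]: then [phi] has no descent direction into [C] at
   [x], the oracle axiom (O2) turns its active slopes into Clarke subgradients,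
   and a minimax argument selects one of them opposite to a normal vector.
   If the radius is halved infinitely often, (O3) at the trial steps and the
   failed acceptance test give such [k] with [r' = R_k]. Otherwise the radius
   is eventually constant and every trial step is [y_k]; the aggregate planes
   make [Phi_k (y_k)] increase by at least [|y_{k+1} - y_k|_Q^2 / 2], and the
   test [rhot < gammat] contracts the gap [f x - Phi_k (y_k)] by the factor
   [gammat] up to a multiple of [|y_{k+1} - y_k|]. *)

(** * Dot product of column vectors and its comparison with the sup norm *)

Section Dot.
Context {R : realType} {n : nat}.
Implicit Types (u v w : 'cV[R]_n) (a : R).

Lemma dotE u v : dot u v = \sum_i u i 0 * v i 0.
Proof. by rewrite /dot mxE; apply: eq_bigr => i _; rewrite mxE. Qed.

Lemma dotC u v : dot u v = dot v u.
Proof. by rewrite !dotE; apply: eq_bigr => i _; rewrite mulrC. Qed.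

Lemma dotDr u v w : dot u (v + w) = dot u v + dot u w.
Proof. by rewrite /dot mulmxDr mxE. Qed.

Lemma dotDl u v w : dot (u + v) w = dot u w + dot v w.
Proof. by rewrite ![dot _ w]dotC dotDr. Qed.

Lemma dotZr a u v : dot u (a *: v) = a * dot u v.
Proof. by rewrite /dot -scalemxAr mxE. Qed.

Lemma dotZl a u v : dot (a *: u) v = a * dot u v.
Proof. by rewrite dotC dotZr dotC. Qed.

Lemma dotNr u v : dot u (- v) = - dot u v.
Proof. by rewrite -scaleN1r dotZr mulN1r. Qed.

Lemma dotNl u v : dot (- u) v = - dot u v.
Proof. by rewrite dotC dotNr dotC. Qed.

Lemma dotBr u v w : dot u (v - w) = dot u v - dot u w.
Proof. by rewrite dotDr dotNr. Qed.

Lemma dotBl u v w : dot (u - v) w = dot u w - dot v w.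
Proof. by rewrite dotDl dotNl. Qed.

Lemma dot0r u : dot u 0 = 0.
Proof. by rewrite /dot mulmx0 mxE. Qed.

Lemma dot0l u : dot 0 u = 0.
Proof. by rewrite dotC dot0r. Qed.

Lemma dot_ge0 u : 0 <= dot u u.
Proof. by rewrite dotE sumr_ge0// => i _; rewrite -expr2 sqr_ge0. Qed.

Lemma dot_eq0 u : dot u u = 0 -> u = 0.
Proof.
rewrite dotE => /eqP; rewrite psumr_eq0; last first.
  by move=> i _; rewrite -expr2 sqr_ge0.
move=> /allP u0; apply/matrixP => i j; rewrite (ord1 j) mxE.
have /u0 : i \in index_enum 'I_n by rewrite mem_index_enum.
by rewrite -expr2 sqrf_eq0 => /eqP.
Qed.

Lemma dot_expand u v a : dot (u + a *: v) (u + a *: v) =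
  dot u u + 2 * a * dot u v + a ^+ 2 * dot v v.
Proof. by rewrite !(dotDr, dotDl, dotZl, dotZr) (dotC v u); ring. Qed.

Lemma dot_symmetric (A : 'M[R]_n) u v : symmetric_mx A ->
  dot u (A *m v) = dot v (A *m u).
Proof. by move=> sA; rewrite dotC /dot trmx_mul sA mulmxA. Qed.

Lemma normr_coord u i : `|u i 0| <= `|u|.
Proof.
rewrite [leRHS]/Num.norm /= mx_normrE.
exact: (le_bigmax _ (fun ij => `|u ij.1 ij.2|) (i, 0)).
Qed.

Lemma normr_coord_le u a : 0 <= a -> (forall i, `|u i 0| <= a) -> `|u| <= a.
Proof.
move=> a0 ua; rewrite [leLHS]/Num.norm /= mx_normrE; apply/bigmax_leP; split => //.
by move=> [i j] _ /=; rewrite (ord1 j).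
Qed.

Lemma normr_dot u v : `|dot u v| <= n%:R * `|u| * `|v|.
Proof.
rewrite dotE (le_trans (ler_norm_sum _ _ _))//.
have -> : n%:R * `|u| * `|v| = \sum_(i < n) (`|u| * `|v|).
  by rewrite sumr_const card_ord -mulrA mulr_natl.
by apply: ler_sum => i _; rewrite normrM ler_pM// normr_coord.
Qed.

Lemma le_normr_sqr u : `|u| ^+ 2 <= dot u u.
Proof.
rewrite -(sqr_sqrtr (dot_ge0 u)) ler_sqr ?nnegrE ?sqrtr_ge0//.
apply: normr_coord_le; first exact: sqrtr_ge0.
move=> i; rewrite -sqrtr_sqr ler_wsqrtr// dotE (bigD1 i)//= -expr2 lerDl.
by rewrite sumr_ge0// => j _; rewrite -expr2 sqr_ge0.
Qed.

End Dot.

(** * Continuity, compactness and subsequences for column vectors *)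

Section Topology.
Context {R : realType} {n : nat}.
Local Notation V := 'cV[R]_n.

Lemma cvg_dot (T : Type) (F : set_system T) (FF : Filter F) (h k : T -> V)
    (u v : V) :
  h @ F --> u -> k @ F --> v -> (fun t => dot (h t) (k t)) @ F --> dot u v.
Proof.
move=> hu kv; under eq_fun do rewrite dotE.
rewrite dotE; apply: cvg_big => [|i _]; first by move=> p; apply: add_continuous.
apply: cvgM.
  apply: (@cvg_comp _ _ _ h (fun M : V => M i 0) F _ _ hu).
  exact: coord_continuous.
apply: (@cvg_comp _ _ _ k (fun M : V => M i 0) F _ _ kv).
exact: coord_continuous.
Qed.

Lemma dot_continuous (u : V) : continuous (dot u).
Proof.
by move=> v; apply: (@cvg_dot _ _ (nbhs_filter v)); [exact: cvg_cst|exact: cvg_id].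
Qed.

Lemma continuous_quadratic (A : 'M[R]_n) :
  continuous (fun u : V => dot u (A *m u)).
Proof.
have coordE (v : V) i : (A *m v) i 0 = dot (row i A)^T v.
  by rewrite dotE mxE; apply: eq_bigr => j _; rewrite !mxE.
have -> : (fun u => dot u (A *m u)) =
    (fun u : V => \sum_i u i 0 * dot (row i A)^T u).
  by apply/funext => u; rewrite dotE; apply: eq_bigr => i _; rewrite coordE.
apply: continuous_big => [p|i _ u]; first exact: add_continuous.
apply: (@cvgM _ _ (nbhs u) (nbhs_filter u)); first exact: coord_continuous.
exact: dot_continuous.
Qed.

Lemma closed_normr_le (a : R) : closed [set u : V | `|u| <= a].
Proof.
have -> : [set u : V | `|u| <= a] = Num.norm @^-1` [set b | b <= a] by [].
by apply: closed_comp => [u _|]; [exact: norm_continuous|exact: closed_le].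
Qed.

(** Transposition preserves the sup norm and is continuous, so Heine-Borel for row vectors carries
    over to columns. *)
Lemma compact_ball (a : R) : compact [set u : V | `|u| <= a].
Proof.
have trc : continuous (trmx : 'rV[R]_n -> V).
  move=> u; apply/(@cvgrPdist_le R V _ (nbhs u)) => e e0; near=> v.
  have uve : `|u - v| <= e by near: v; exact: cvgr_dist_le.
  apply: normr_coord_le; first exact: ltW.
  move=> i; rewrite !mxE; apply: le_trans uve.
  rewrite [leRHS]/Num.norm /= mx_normrE.
  by have := le_bigmax 0 (fun ij => `|(u - v) ij.1 ij.2|) (0, i); rewrite /= !mxE.
have ntr (u : 'rV[R]_n) : `|u^T| = `|u|.
  apply/eqP; rewrite eq_le; apply/andP; split.
    apply: normr_coord_le => // i; rewrite mxE [leRHS]/Num.norm /= mx_normrE.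
    exact: (le_bigmax _ (fun ij => `|u ij.1 ij.2|) (0, i)).
  rewrite [leLHS]/Num.norm /= mx_normrE; apply/bigmax_leP; split => // -[i j] _ /=.
  by rewrite (ord1 i); have := normr_coord u^T j; rewrite mxE.
have -> : [set u : V | `|u| <= a] = trmx @` [set u : 'rV[R]_n | `|u| <= a].
  rewrite eqEsubset; split => u /=.
    by move=> ua; exists u^T; rewrite ?trmxK// -ntr trmxK.
  by move=> [v va <-]; rewrite ntr.
apply: continuous_compact; first exact: continuous_subspaceT.
apply: bounded_closed_compact.
  by exists a; split => [|b ab v /= va]; [exact: num_real|rewrite (le_trans va)// ltW].
have -> : [set u : 'rV[R]_n | `|u| <= a] = Num.norm @^-1` [set b | b <= a] by [].
by apply: closed_comp => [u _|]; [exact: norm_continuous|exact: closed_le].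
Unshelve. all: by end_near. Qed.

Lemma closed_dot_le (u : V) (a : R) : closed [set v : V | dot u v <= a].
Proof.
have -> : [set v : V | dot u v <= a] = dot u @^-1` [set b | b <= a] by [].
by apply: closed_comp => [v _|]; [exact: dot_continuous|exact: closed_le].
Qed.

(** Compactness yields a cluster point, and [phi k] is picked beyond [k] with [u (phi k)] within
    [1/(k+1)] of it. The condition [k <= phi k] stands in for strict monotonicity and suffices to
    pass limits along [phi]. *)
Lemma bounded_subsequence (a : R) (u : nat -> V) : (forall k, `|u k| <= a) ->
  exists (p : V) (phi : nat -> nat),
    (forall k, (k <= phi k)%N) /\ u \o phi @ \oo --> p.
Proof.
move=> ua.
have [p [_ clp]] : [set v : V | `|v| <= a] `&` cluster (u @ \oo) !=set0.
  apply: (@compact_ball a (u @ \oo)).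
  by exists 0%N => // k _ /=; exact: ua.
have ex k : exists j, (k <= j)%N /\ `|p - u j| < k.+1%:R^-1.
  have kV0 : 0 < k.+1%:R^-1 :> R by rewrite invr_gt0 ltr0n.
  have [v [[j /= kj <-] pv]] := clp (u @` [set j | (k <= j)%N])
    (ball p k.+1%:R^-1)
    (ex_intro2 _ _ k I (fun j kj => ex_intro2 _ _ j kj erefl))
    (nbhsx_ballx p _ kV0).
  by exists j; split => //; move: pv; rewrite -ball_normE.
have [phi phiP] := choice ex.
exists p, phi; split => [k|]; first by have [] := phiP k.
apply/cvgrPdist_lt => e e0; near=> k.
apply: lt_trans (proj2 (phiP k)) _; near: k.
exact: near_infty_natSinv_lt (PosNum e0).
Unshelve. all: by end_near. Qed.

Lemma cvg_subsequence (T : topologicalType) (u : nat -> T) (phi : nat -> nat)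
  (l : T) : (forall k, (k <= phi k)%N) -> u @ \oo --> l -> u \o phi @ \oo --> l.
Proof.
move=> kphi ul; apply: (@cvg_comp _ _ _ phi u \oo \oo) => // A [m _ mA].
by exists m => // k /= mk; apply: mA => /=; exact: leq_trans (kphi k).
Qed.

Lemma sphere_min (h : V -> R) : continuous h ->
  (forall u, `|u| = 1 -> 0 < h u) ->
  exists2 c, 0 < c & forall u, `|u| = 1 -> c <= h u.
Proof.
move=> ch h0; have [S0|] := pselect ([set u : V | `|u| = 1] !=set0); last first.
  by move=> S0; exists 1 => // u u1; exfalso; apply: S0; exists u.
have cS : compact [set u : V | `|u| = 1].
  apply: (subclosed_compact _ (@compact_ball 1)) => [|u /= -> //].
  have -> : [set u : V | `|u| = 1] = Num.norm @^-1` [set 1] by [].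
  apply: closed_comp => [u _|]; [exact: norm_continuous|exact: closed_eq].
have [c] := compact_EVT_min S0 cS (continuous_subspaceT ch).
rewrite inE /= => c1 cmin; exists (h c); first exact: h0.
by move=> u u1; apply: cmin; rewrite inE.
Qed.

End Topology.

(** * Equivalence of an abstract norm with the sup norm, and coercivity of positive definite
    forms *)

Section Norms.
Context {R : realType} {n : nat}.
Local Notation V := 'cV[R]_n.
Variable (N : V -> R).
Hypothesis hN : is_norm N.

Lemma is_norm0 : N 0 = 0.
Proof. by rewrite -(scale0r 0) (is_normZ hN) normr0 mul0r. Qed.

Lemma is_normN u : N (- u) = N u.
Proof. by rewrite -scaleN1r (is_normZ hN) normrN1 mul1r. Qed.

Lemma is_norm_ge0 u : 0 <= N u.
Proof.
have := is_normD hN u (- u); rewrite subrr is_norm0 is_normN => h.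
by rewrite -(pmulrn_lge0 _ (isT : 0 < 2)%N) mulr2n.
Qed.

Lemma is_norm_le : exists2 K, 0 <= K & forall u, N u <= K * `|u|.
Proof.
exists (\sum_i N (delta_mx i 0)); first by apply: sumr_ge0 => i _; exact: is_norm_ge0.
move=> u; rewrite {1}(matrix_sum_delta u) mulr_suml.
have Nsum (h : 'I_n -> V) : N (\sum_i h i) <= \sum_i N (h i).
  elim/big_ind2: _ => //; first by rewrite is_norm0.
  by move=> a b c d ab cd; apply: le_trans (is_normD hN _ _) _; exact: lerD.
apply: le_trans (Nsum _) _; apply: ler_sum => i _.
by rewrite big_ord1 (is_normZ hN) mulrC ler_wpM2l ?is_norm_ge0 ?normr_coord.
Qed.

Lemma is_norm_continuous : continuous N.
Proof.
have [K K0 NK] := is_norm_le.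
have NB u v : `|N u - N v| <= K * `|u - v|.
  rewrite ler_norml; apply/andP; split.
    rewrite lerNl opprB lerBlDr distrC.
    apply: le_trans (lerD (NK _) (lexx _)).
    by apply: le_trans (is_normD hN _ _); rewrite subrK.
  rewrite lerBlDr; apply: le_trans (lerD (NK _) (lexx _)).
  by apply: le_trans (is_normD hN _ _); rewrite subrK.
have K1 : 0 < K + 1 by rewrite ltr_pwDr.
move=> u; apply/(@cvgrPdist_le R R _ (nbhs u)) => e e0; near=> v.
apply: le_trans (NB _ _) _.
apply: (@le_trans _ _ ((K + 1) * `|u - v|)).
  by rewrite ler_wpM2r// lerDl.
rewrite -ler_pdivlMl//; near: v; apply: cvgr_dist_le => //.
by rewrite mulr_gt0// invr_gt0.
Unshelve. all: by end_near. Qed.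

Lemma is_norm_ge : exists2 c, 0 < c & forall u, c * `|u| <= N u.
Proof.
have [|c c0 cN] := sphere_min is_norm_continuous.
  move=> u u1; rewrite lt_neqAle is_norm_ge0 andbT eq_sym.
  apply/eqP => /(is_norm0_eq0 hN) u0; move: u1.
  by rewrite u0 normr0 => /eqP; rewrite eq_sym oner_eq0.
exists c => // u; have [->|u0] := eqVneq u 0; first by rewrite normr0 mulr0 is_norm_ge0.
have nu0 : 0 < `|u| by rewrite normr_gt0.
rewrite -ler_pdivlMr// -[`|u|]normr_id mulrC -normfV -(is_normZ hN).
by apply: cN; rewrite normrZ normfV normr_id mulVf// gt_eqF.
Qed.

End Norms.

Lemma posdef_ge (R : realType) (n : nat) (Q : 'M[R]_n) : posdef_mx Q ->
  exists2 c, 0 < c & forall u : 'cV[R]_n, c * `|u| ^+ 2 <= dot u (Q *m u).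
Proof.
move=> Q0; have [|c c0 cQ] := sphere_min (@continuous_quadratic R n Q).
  move=> u u1; apply: Q0; apply/eqP => u0; move: u1.
  by rewrite u0 normr0 => /eqP; rewrite eq_sym oner_eq0.
exists c => // u; have [->|u0] := eqVneq u 0.
  by rewrite normr0 expr0n mulr0 dot0l.
have nu0 : 0 < `|u| by rewrite normr_gt0.
have := cQ (`|u|^-1 *: u); rewrite -scalemxAr dotZl dotZr normrZ normfV normr_id.
rewrite mulVf ?gt_eqF// => /(_ erefl).
by rewrite mulrA -invfM -expr2 ler_pdivlMl ?exprn_gt0// mulrC.
Qed.

(** * Projection, separation and minimax for closed convex sets *)

Section Separation.
Context {R : realType} {n : nat}.
Local Notation V := 'cV[R]_n.
Implicit Types (A C K : set V) (p u v : V).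

(** Trades [conv], whose scalars live in the unit-interval type, for segments with a bare real
    parameter. *)
Lemma convex_setP A : convex_set A <->
  forall u v (t : R), A u -> A v -> 0 <= t -> t <= 1 -> A (u + t *: (v - u)).
Proof.
split=> [cA u v t Au Av t0 t1|cA u v t].
  have t01 : Itv.spec (@Itv.num_sem R) (Itv.Real `[0%Z, 1%Z]) t.
    by rewrite /Itv.spec /= /Itv.num_sem /= num_real/= in_itv/= t0 t1.
  have /set_mem := cA v u (Itv.mk t01) (mem_set Av) (mem_set Au).
  rewrite /conv /=; congr A.
  by rewrite scalerBr scalerBl scale1r addrCA addrC.
rewrite !inE => Au Av; have := cA v u t%:num Av Au.
rewrite ge0 le1 => /(_ isT isT); congr A.
by rewrite /conv /= scalerBr scalerBl scale1r addrCA addrC.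
Qed.

Lemma closed_sequential A :
  (forall (u : nat -> V) p, (forall k, A (u k)) -> u @ \oo --> p -> A p) ->
  closed A.
Proof.
move=> hA p clp.
have ex k : exists v, A v /\ `|p - v| < k.+1%:R^-1.
  have kV0 : 0 < k.+1%:R^-1 :> R by rewrite invr_gt0 ltr0n.
  have [v [Av]] := clp _ (nbhsx_ballx p _ kV0).
  by rewrite -ball_normE /= => pv; exists v.
have [u uP] := choice ex.
apply: (hA u) => [k|]; first by have [] := uP k.
apply/cvgrPdist_lt => e e0; near=> k.
apply: lt_trans (proj2 (uP k)) _; near: k.
exact: near_infty_natSinv_lt (PosNum e0).
Unshelve. all: by end_near. Qed.

Lemma sequential_closed A (u : nat -> V) p : closed A ->
  (forall k, A (u k)) -> u @ \oo --> p -> A p.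
Proof.
move=> cA Au up; apply: (@closed_cvg _ _ \oo _ u A cA _ p up).
by exists 0%N => // k _; exact: Au.
Qed.

Lemma convex_projection A c : closed A -> convex_set A -> A !=set0 ->
  exists2 a, A a & forall b, A b -> 0 <= dot (a - c) (b - a).
Proof.
move=> cA /convex_setP convA [a0 Aa0].
pose h v := dot (v - c) (v - c).
have ch : continuous h.
  move=> v; apply: (@cvg_dot _ _ _ _ (nbhs_filter v));
    by apply: (@cvgB _ _ _ _ (nbhs_filter v)); [exact: cvg_id|exact: cvg_cst].
(* Outside radius [r] the norm of [v - c] exceeds [1 + h a0], so its square, a lower bound for
   [h v], exceeds [h a0]; minimizing over a compact part of [A] is enough. *)
pose r := `|c| + (1 + h a0).
have far v : r < `|v| -> h a0 < h v.
  move=> rv; apply: lt_le_trans (le_normr_sqr _).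
  have vc : 1 + h a0 < `|v - c|.
    by have := ler_normD (v - c) c; rewrite subrK; move: rv; rewrite /r; lra.
  by have := dot_ge0 (a0 - c); rewrite -/(h a0); nra.
have ra0 : `|a0| <= r by rewrite leNgt; apply/negP => /far; rewrite ltxx.
have cpt : compact (A `&` [set v | `|v| <= r]).
  apply: (subclosed_compact _ (@compact_ball _ _ r)) => [|v []//].
  by apply: closedI => //; exact: closed_normr_le.
have [|a] := compact_EVT_min _ cpt (continuous_subspaceT ch); first by exists a0.
rewrite inE => -[Aa ra] amin; exists a => // b Ab.
have {}amin v : A v -> h a <= h v.
  move=> Av; have [vr|vr] := leP `|v| r; first by apply: amin; rewrite inE.
  by apply: le_trans (ltW (far _ vr)); apply: amin; rewrite inE.
rewrite leNgt; apply/negP => neg.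
pose q := dot (b - a) (b - a); have q0 : 0 <= q := dot_ge0 _.
pose e := - dot (a - c) (b - a); have e0 : 0 < e by rewrite /e; lra.
(* This step lies in [(0, 1]] and has [t * q <= e], so moving from [a] towards [b] lowers [h] by at
   least [t * e]. *)
pose t := e / (e + q).
have t0 : 0 < t by rewrite divr_gt0// ltr_pwDl.
have t1 : t <= 1 by rewrite ler_pdivrMr ?mul1r ?ltr_pwDl// lerDl.
have := amin _ (convA a b t Aa Ab (ltW t0) t1).
have -> : h (a + t *: (b - a)) = h a - 2 * t * e + t ^+ 2 * q.
  rewrite /h (_ : a + t *: (b - a) - c = (a - c) + t *: (b - a)).
    by rewrite dot_expand /e /q; ring.
  by rewrite addrAC.
have tE : t * (e + q) = e by rewrite /t divfK// gt_eqF// ltr_pwDl.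
by nra.
Qed.

(** Take for [p] the vector from [c] to its projection on [A]; the variational inequality of the
    projection gives the margin [dot p p]. *)
Lemma convex_separation A c : closed A -> convex_set A -> A !=set0 -> ~ A c ->
  exists2 p, 0 < dot p p & forall b, A b -> dot p c + dot p p <= dot p b.
Proof.
move=> cA convA A0 Ac; have [a Aa aP] := convex_projection c cA convA A0.
exists (a - c) => [|b /aP].
  rewrite lt_neqAle dot_ge0 andbT eq_sym; apply/eqP => /dot_eq0/eqP.
  by rewrite subr_eq0 => /eqP ac; apply: Ac; rewrite -ac.
by rewrite !(dotBr (a - c)); lra.
Qed.

(* Minimax for the bilinear form [dot s (u - x)]: if [K] avoids the dual cone
   [P] of [C - x], separate [K - P] from [0] by [p]; the difference quotients
   at [x] of the projections of [x - t p] onto [C] then tend to [- p]. *)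
Lemma convex_minimax K C x (a : R) : closed K -> convex_set K -> K !=set0 ->
  (forall s, K s -> `|s| <= a) ->
  closed C -> convex_set C -> C x ->
  (forall u, C u -> exists2 s, K s & 0 <= dot s (u - x)) ->
  exists2 s, K s & forall u, C u -> 0 <= dot s (u - x).
Proof.
move=> cK convK [s0 Ks0] Ka cC convC Cx KC.
pose P := [set w : V | forall u, C u -> 0 <= dot w (u - x)].
have cP (w : nat -> V) (p : V) : (forall k, P (w k)) -> w @ \oo --> p -> P p.
  move=> Pw wp u Cu; rewrite dotC -oppr_le0 -dotNl.
  have /= h := sequential_closed (@closed_dot_le R n (- (u - x)) 0) _ wp.
  apply: h => k.
  by rewrite dotNl oppr_le0 dotC; exact: Pw.
apply: contrapT => noK.
pose D := [set s - w | s in K & w in P].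
(* Elements of [K] are bounded, so they converge along a subsequence, and with them the elements of
   [P]. *)
have cD : closed D.
  apply: closed_sequential => d p Dd dp.
  have [sw swP] := choice (fun k =>
    (let: ex_intro2 s Ks (ex_intro2 w Pw e) := Dd k in
     ex_intro (fun q : V * V => [/\ K q.1, P q.2 & q.1 - q.2 = d k])
       (s, w) (And3 Ks Pw e))).
  have [s [phi [kphi sphi]]] : exists (s : V) (phi : nat -> nat),
      (forall k, (k <= phi k)%N) /\ (fst \o sw) \o phi @ \oo --> s.
    by apply: (@bounded_subsequence _ _ a) => k; apply: Ka; have [] := swP k.
  exists s; first by apply: (sequential_closed cK _ sphi) => k /=; have [] := swP (phi k).
  exists (s - p); last by rewrite opprB addrC subrK.
  apply: (cP (fun k => (sw (phi k)).1 - d (phi k))) => [k|].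
    by have [_ + <-] := swP (phi k); rewrite opprB addrC subrK.
  by apply: cvgB => //; exact: (cvg_subsequence kphi dp).
have convD : convex_set D.
  apply/convex_setP => _ _ t [s Ks [w Pw <-]] [s' Ks' [w' Pw' <-]] t0 t1.
  exists (s + t *: (s' - s)); first by move/convex_setP : convK; exact.
  exists (w + t *: (w' - w)).
    move=> u Cu; rewrite dotDl dotZl dotBl.
    by have := Pw _ Cu; have := Pw' _ Cu; nra.
  by apply/matrixP => i j; rewrite !mxE; ring.
have P0 : P 0 by move=> u _; rewrite dot0l.
have [||p p0 pD] := convex_separation (c := 0) cD convD.
- by exists (s0 - 0), s0 => //; exists 0.
- move=> [s Ks [w Pw /eqP]]; rewrite subr_eq0 => /eqP sw.
  by apply: noK; exists s; rewrite // sw.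
have pK s : K s -> dot p p <= dot p s.
  move=> Ks; rewrite -[s]subr0 -[X in X <= _]add0r -(dot0r p).
  by apply: pD; exists s => //; exists 0.
have pP w : P w -> dot p w <= 0.
  move=> Pw; rewrite leNgt; apply/negP => pw.
  (* As [P] is a cone, [s0 - t *: w] stays in [D]; this [t] makes its product with [p] nonpositive,
     against the margin [dot p p]. *)
  pose t := `|dot p s0| / dot p w.
  have t0 : 0 <= t by rewrite divr_ge0// ltW.
  have /pD : D (s0 - t *: w).
    by exists s0 => //; exists (t *: w) => // u Cu; rewrite dotZl mulr_ge0//; exact: Pw.
  rewrite dot0r dotBr dotZr /t divfK ?gt_eqF//.
  by have := ler_norm (dot p s0); lra.
pose l k : R := k.+1%:R^-1.
have l0 k : 0 < l k by rewrite invr_gt0 ltr0n.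
have [b bP] := choice (fun k =>
  let: ex_intro2 b Cb bm :=
    convex_projection (x - l k *: p) cC convC (ex_intro _ x Cx) in
  ex_intro (fun b => C b /\ forall u, C u -> 0 <= dot (b - (x - l k *: p)) (u - b))
    b (conj Cb bm)).
pose d k := (l k)^-1 *: (b k - x).
have bE k : b k = x + l k *: d k.
  by rewrite /d scalerA divff ?gt_eqF// scale1r addrC subrK.
have bEP k : b k - (x - l k *: p) = l k *: (d k + p).
  by rewrite bE scalerDr; apply/matrixP => i j; rewrite !mxE; ring.
(* The projection inequality tested at [x]; it also keeps the quotients [d k] bounded. *)
have dd k : dot (d k + p) (d k) <= 0.
  have [_ /(_ x Cx)] := bP k.
  have -> : x - b k = - (l k *: d k) by rewrite bE opprD addNKr.
  by rewrite bEP dotZl dotNr dotZr mulrN oppr_ge0 !pmulr_rle0.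
have [d_ [phi [kphi dphi]]] : exists (d_ : V) (phi : nat -> nat),
    (forall k, (k <= phi k)%N) /\ d \o phi @ \oo --> d_.
  apply: (@bounded_subsequence _ _ (n%:R * `|p|)) => k.
  have [->|dk0] := eqVneq (d k) 0; first by rewrite normr0 mulr_ge0.
  have nd0 : 0 < `|d k| by rewrite normr_gt0.
  have := dd k; rewrite dotDl => dpk.
  have := le_normr_sqr (d k); have := normr_dot p (d k).
  rewrite ler_norml => /andP[+ _] => h1 h2.
  by rewrite -(ler_pM2r nd0) -expr2; lra.
have lphi : l \o phi @ \oo --> (0 : R).
  by apply: (cvg_subsequence kphi); exact: cvg_harmonic.
have bphi : b \o phi @ \oo --> x.
  have -> : b \o phi = (fun k => x + (l \o phi) k *: (d \o phi) k).
    by apply/funext => k /=; rewrite bE.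
  have : (fun k => x + (l \o phi) k *: (d \o phi) k) @ \oo --> x + 0 *: d_.
    by apply: cvgD; [exact: cvg_cst|exact: cvgZ].
  by rewrite scale0r addr0.
have dpphi : (fun k => d (phi k) + p) @ \oo --> d_ + p.
  by apply: cvgD => //; exact: cvg_cst.
have limit_ge0 (h : nat -> R) (y : R) :
    (forall k, 0 <= h k) -> h @ \oo --> y -> 0 <= y.
  move=> h0 hy; apply: (@closed_cvg _ _ \oo _ h _ (@closed_ge _ 0) _ y hy).
  by exists 0%N => // k _; exact: h0.
have Pd : P (d_ + p).
  move=> u Cu; apply: (limit_ge0 (fun k => dot (d (phi k) + p) (u - b (phi k)))).
    move=> k; have [_ /(_ u Cu)] := bP (phi k).
    by rewrite bEP dotZl pmulr_rge0.
  by apply: cvg_dot => //; apply: cvgB => //; exact: cvg_cst.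
have ddlim : dot (d_ + p) d_ <= 0.
  rewrite -oppr_ge0; apply: (limit_ge0 (fun k => - dot (d (phi k) + p) (d (phi k)))).
    by move=> k; rewrite oppr_ge0.
  by apply: cvgN; exact: cvg_dot.
(* Adding [dot (d_ + p) d_ <= 0] and [dot p (d_ + p) <= 0] makes the squared length of [d_ + p]
   nonpositive. *)
have dE : d_ = - p.
  apply/eqP; rewrite -addr_eq0; apply/eqP/dot_eq0/eqP.
  rewrite eq_le dot_ge0 andbT dotDr (dotC _ p).
  by have := pP _ Pd; lra.
(* The hypothesis at the projections gives slopes in [K] with a limit [q] such that
   [dot q (- p) >= 0], against [dot p q >= dot p p > 0]. *)
have [s sP] := choice (fun k => let: ex_intro2 s Ks h := KC _ (proj1 (bP (phi k))) in
  ex_intro (fun s => K s /\ 0 <= dot s (b (phi k) - x)) s (conj Ks h)).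
have sd k : 0 <= dot (s k) (d (phi k)).
  have [_] := sP k.
  have -> : b (phi k) - x = l (phi k) *: d (phi k) by rewrite bE addrC addKr.
  by rewrite dotZr pmulr_rge0.
have [q [psi [kpsi spsi]]] : exists (q : V) (psi : nat -> nat),
    (forall k, (k <= psi k)%N) /\ s \o psi @ \oo --> q.
  by apply: (@bounded_subsequence _ _ a) => k; apply: Ka; have [] := sP k.
have Kq : K q by apply: (sequential_closed cK _ spsi) => k; have [] := sP (psi k).
have : 0 <= dot q d_.
  apply: (limit_ge0 (fun k => dot (s (psi k)) (d (phi (psi k)))));
    first by move=> k.
  by apply: cvg_dot => //; exact: (cvg_subsequence kpsi dphi).
by rewrite dE dotNr dotC; have := pK _ Kq; lra.
Qed.

End Separation.

(** * Closedness and convexity of the Clarke subdifferential *)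

Section Clarke.
Context {R : realType} {n : nat}.
Local Notation V := 'cV[R]_n.
Variables (f : V -> R) (c : V).

(** The set is an intersection of half-spaces, one per direction; a bound [+oo] imposes nothing and
    a bound [-oo] leaves no subgradient. *)
Lemma clarke_subdiff_closed : closed (clarke_subdiff f c).
Proof.
apply: closed_sequential => s p sP sp d; have {}sP k := sP k d.
case: (clarke_derivative f c d) sP => [l sP| sP|sP].
- rewrite lee_fin dotC.
  have /= h := sequential_closed (@closed_dot_le R n d l) _ sp.
  by apply: h => k; rewrite dotC -lee_fin.
- exact: leey.
- by have := sP 0%N.
Qed.

Lemma clarke_subdiff_convex : convex_set (clarke_subdiff f c).
Proof.
apply/convex_setP => u v t uP vP t0 t1 d; have {}uP := uP d; have {}vP := vP d.
case: (clarke_derivative f c d) uP vP => [l uP vP|_ _|uP _].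
- rewrite !lee_fin dotDl dotZl dotBl in uP vP *; nra.
- exact: leey.
- by [].
Qed.

End Clarke.

(** * Suprema of bounded families of planes *)

Section Models.
Context {R : realType} {n : nat}.
Local Notation V := 'cV[R]_n.
Implicit Types (W : set (R * V)) (p : R * V) (u : V).
Variables (x : V).

Definition bounded_planes W : Prop :=
  exists G, forall p, W p -> `|p.1| <= G /\ `|p.2| <= G.

Lemma bounded_planesP W : bounded_set W -> bounded_planes W.
Proof.
move=> [G [_ hG]]; exists (G + 1) => p Wp.
have := hG (G + 1) (ltac:(by rewrite ltrDl)) p Wp.
by rewrite /= prod_normE ge_max => /andP.
Qed.

Lemma bounded_planesU W1 W2 :
  bounded_planes W1 -> bounded_planes W2 -> bounded_planes (W1 `|` W2).
Proof.
move=> [G1 h1] [G2 h2]; exists (Num.max G1 G2) => p [/h1|/h2] [p1 p2];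
  by rewrite !le_max p1 p2 ?orbT.
Qed.

Lemma plane_eval_le_model1 W p u : bounded_planes W -> W p ->
  plane_eval x p u <= model1 x W u.
Proof.
move=> [G hG] Wp; apply: sup_ubound; last by exists p.
exists (G + n%:R * G * `|u - x|) => _ [q Wq <-]; have [q1 q2] := hG q Wq.
apply: lerD; first exact: le_trans (ler_norm _) q1.
apply: le_trans (ler_norm _) (le_trans (normr_dot _ _) _).
by rewrite ler_wpM2r// ler_wpM2l.
Qed.

Lemma model1_le W u (b : R) : W !=set0 ->
  (forall p, W p -> plane_eval x p u <= b) -> model1 x W u <= b.
Proof.
move=> [p Wp] h; apply: ge_sup; first by exists (plane_eval x p u), p.
by move=> _ [q Wq <-]; exact: h.
Qed.

Lemma model1_adherent W u (e : R) : W !=set0 -> bounded_planes W -> 0 < e ->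
  exists2 p, W p & model1 x W u - e < plane_eval x p u.
Proof.
move=> W0 bW e0; apply: contrapT => h.
have : model1 x W u <= model1 x W u - e; last by lra.
by apply: model1_le => // p Wp; rewrite leNgt; apply/negP => ?; apply: h; exists p.
Qed.

Lemma plane_eval_aggregate W y g u :
  plane_eval x (aggregate_plane x W y g) u = model1 x W y + dot g (u - y).
Proof. by rewrite /plane_eval /= !dotBr; ring. Qed.

Lemma convex_subdiff_indic (C : set V) (h : V -> R) y g :
  convex_subdiff (fun u => ((h u)%:E + indic_fun C u)%E) y g ->
  forall u, C u -> h y + dot g (u - y) <= h u.
Proof.
move=> [hy hg] u Cu; have := hg u; move: hy.
rewrite /indic_fun; case: ifPn => //= _ _; rewrite (mem_set Cu) !adde0.
by rewrite -EFinD lee_fin.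
Qed.

End Models.

(** * The envelope of the oracle planes and a criterion for stationarity *)

Section Criterion.
Context {R : realType} {n : nat}.
Local Notation V := 'cV[R]_n.
Variables (N : V -> R) (hN : is_norm N) (M : R) (hM : 0 < M) (f : V -> R).
Variables (O : V -> V -> set (R * V)) (hO : cutting_plane_oracle N M f O).
Variables (C : set V) (x : V) (hx : C x) (Q : 'M[R]_n).

Definition oracle_planes : set (R * V) :=
  [set p | exists2 z, N (z - x) <= M & O z x p].

Local Notation envelope := (model1 x oracle_planes).

(** [N] dominates a multiple of the sup norm, so the admissible calls form a bounded set, on which
    the oracle is uniformly bounded. *)
Lemma oracle_planes_bounded : bounded_planes oracle_planes.
Proof.
have [c c0 cN] := is_norm_ge hN.
pose B := [set zx : V * V | N (zx.1 - x) <= M /\ zx.2 = x].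
have : bounded_set B.
  exists (c^-1 * M + `|x|); split; first exact: num_real.
  move=> b Mb [z _] [/= zM ->]; apply: le_trans (ltW Mb).
  rewrite prod_normE ge_max /=; apply/andP; split.
    have := ler_normD (z - x) x; rewrite subrK => /le_trans; apply.
    by rewrite lerD2r ler_pdivlMl// (le_trans (cN _)).
  by rewrite lerDr mulr_ge0 ?invr_ge0 ?ltW.
move=> /(oracle_bounded_on_bounded hO)/bounded_planesP[G hG].
by exists G => p [z zM Op]; apply: hG; exists (z, x).
Qed.

Lemma exactness_planes_oracle : exactness_planes f O x `<=` oracle_planes.
Proof.
by move=> p [Op _]; exists x => //; rewrite subrr (is_norm0 hN) ltW.
Qed.

Lemma exactness_planes_neq0 : exactness_planes f O x !=set0.
Proof. by have [g Og _] := oracle_O1_exact hO x; exists (f x, g). Qed.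

Lemma oracle_planes_neq0 : oracle_planes !=set0.
Proof.
by have [p /exactness_planes_oracle] := exactness_planes_neq0; exists p.
Qed.

(** Invariant of the working sets along the loop. The envelope bound is confined to [C] because an
    aggregate plane may exceed the envelope elsewhere. *)
Record working_set (W : set (R * V)) : Prop := WorkingSet {
  working_bounded : bounded_planes W;
  working_exact : W `&` exactness_planes f O x !=set0;
  working_le : forall p u, W p -> C u -> plane_eval x p u <= envelope u }.

Lemma working_neq0 W : working_set W -> W !=set0.
Proof. by move=> [_ [p [Wp _]] _]; exists p. Qed.

Lemma oracle_working W : W `<=` oracle_planes ->
  W `&` exactness_planes f O x !=set0 -> working_set W.
Proof.
move=> WP W0; split => //.
  by have [G hG] := oracle_planes_bounded; exists G => p /WP /hG.
by move=> p u /WP Wp _; apply: plane_eval_le_model1 Wp; exact: oracle_planes_bounded.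
Qed.

Lemma envelope_base : envelope x <= f x.
Proof.
apply: model1_le; first exact: oracle_planes_neq0.
move=> [a g] [z _ Op]; rewrite /plane_eval subrr dot0r addr0.
exact: (oracle_O1_minor hO Op).
Qed.

Lemma model1_le_envelope W u : working_set W -> C u ->
  model1 x W u <= envelope u.
Proof.
move=> wW Cu; apply: model1_le; first exact: working_neq0.
by move=> p Wp; exact: (working_le wW).
Qed.

(** An exactness plane gives [f x] as a lower bound, and the offsets allowed by (O1) give it as an
    upper bound through the envelope. *)
Lemma model1_base W : working_set W -> model1 x W x = f x.
Proof.
move=> wW; apply/eqP; rewrite eq_le; apply/andP; split.
  exact: le_trans (model1_le_envelope wW hx) envelope_base.
have [[a g] [Wp [_ /= aE]]] := working_exact wW.
have := plane_eval_le_model1 x x (working_bounded wW) Wp.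
by rewrite /plane_eval /= subrr dot0r addr0 aE.
Qed.

Lemma model2_base W : working_set W -> model2 x Q W x = f x.
Proof. by move=> wW; rewrite /model2 subrr mulmx0 dot0r mulr0 addr0 model1_base. Qed.

Lemma null_step_working W r y g t W' : working_set W -> N (t - x) <= M ->
  aggregate_subgradient N C x Q W r y g ->
  null_step_set f O x W y g t W' -> working_set W'.
Proof.
move=> wW tM [/convex_subdiff_indic ag _] [W'0 _ _ W'W]; split => //.
  have : bounded_planes (W `|` [set aggregate_plane x W y g] `|` oracle_planes).
    apply: bounded_planesU; last exact: oracle_planes_bounded.
    apply: bounded_planesU; first exact: working_bounded wW.
    exists (Num.max `|(aggregate_plane x W y g).1| `|g|) => _ -> /=.
    by rewrite !le_max !lexx orbT.
  move=> [G hG]; exists G => p /W'W [[[Wp|Ep]|Ap]|Op]; apply: (hG p).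
  - by left; left.
  - by right; exact: exactness_planes_oracle.
  - by left; right.
  - by right; exists t.
move=> p u /W'W + Cu => -[[[Wp|Ep]|->]|Op].
- exact: (working_le wW).
- apply: plane_eval_le_model1; first exact: oracle_planes_bounded.
  exact: exactness_planes_oracle.
- by rewrite plane_eval_aggregate (le_trans (ag _ Cu))// model1_le_envelope.
- by apply: plane_eval_le_model1; [exact: oracle_planes_bounded|exists t].
Qed.

(* Along the difference quotients of the envelope in direction [u - x], almost
   active oracle planes have offsets tending to [f x], so that [oracle_O2]
   makes the limit of their slopes a Clarke subgradient. *)
Lemma envelope_subgradient (G : R) (d : V) :
  (forall p, oracle_planes p -> `|p.1| <= G /\ `|p.2| <= G) ->
  (forall e : R, 0 < e ->
     exists t, [/\ 0 < t, t < e & f x - e * t <= envelope (x + t *: d)]) ->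
  exists2 s, clarke_subdiff f x s /\ `|s| <= G & 0 <= dot s d.
Proof.
move=> hG hd; pose e k : R := k.+1%:R^-1.
have e0 k : 0 < e k by rewrite invr_gt0 ltr0n.
have ex k : exists q : V * (R * V), [/\ N (q.1 - x) <= M, O q.1 x q.2,
    f x - e k * (2 * e k + n%:R * G * `|d|) <= q.2.1 &
    - (2 * e k) <= dot q.2.2 d].
  have [t [t0 te ht]] := hd _ (e0 k).
  (* A slack proportional to [t] survives division by [t]: combined with [a <= f x] it bounds the
     slope along [d] from below by [- 2 * e k]. *)
  have [[a g] Pp] := model1_adherent x (x + t *: d) oracle_planes_neq0
    oracle_planes_bounded (mulr_gt0 (e0 k) t0).
  have [/= _ gG] := hG _ Pp; have [z zM Oz] := Pp.
  rewrite /plane_eval /= addrAC subrr add0r dotZr => hp.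
  exists (z, (a, g)); split => //=.
    have B0 : 0 <= n%:R * G * `|d| by rewrite mulr_ge0// mulr_ge0// (le_trans _ gG).
    have gB : dot g d <= n%:R * G * `|d|.
      apply: le_trans (ler_norm _) (le_trans (normr_dot _ _) _).
      by rewrite ler_wpM2r// ler_wpM2l.
    have := ler_wpM2l (ltW t0) gB; have := ler_wpM2r B0 (ltW te).
    have := ler_wpM2l (ltW (e0 k)) (ltW te).
    by lra.
  have af := oracle_O1_minor hO Oz.
  by rewrite -(ler_pM2l t0); lra.
have [q qP] := choice ex.
have [s [phi [kphi sphi]]] : exists (s : V) (phi : nat -> nat),
    (forall k, (k <= phi k)%N) /\ (fun k => (q k).2.2) \o phi @ \oo --> s.
  apply: (@bounded_subsequence _ _ G) => k; have [qM Oq _ _] := qP k.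
  by have [] := hG (q k).2; first by exists (q k).1.
have eoo : e @ \oo --> (0 : R) by exact: cvg_harmonic.
have aoo : (fun k => (q k).2.1) @ \oo --> f x.
  apply: (@squeeze_cvgr _ _ _ _
    (fun k => f x - e k * (2 * e k + n%:R * G * `|d|)) (fun=> f x)).
  - near=> k; have [_ Oq -> _] := qP k; rewrite /=.
    by move: Oq; case: (q k) => z [a g] /= /(oracle_O1_minor hO).
  - rewrite -[X in _ --> X]subr0 -[X in _ - X](mul0r (2 * 0 + n%:R * G * `|d|)).
    apply: cvgB; first exact: cvg_cst.
    apply: cvgM => //; apply: cvgD; last exact: cvg_cst.
    by apply: cvgM => //; exact: cvg_cst.
  - exact: cvg_cst.
exists s; first split.
- apply: (oracle_O2 hO (z_ := fun k => (q (phi k)).1)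
    (a_ := fun k => (q (phi k)).2.1) (g_ := fun k => (q (phi k)).2.2)) => //.
  + by move=> k; have [_ + _ _] := qP (phi k); rewrite -surjective_pairing.
  + exact: (cvg_subsequence kphi aoo).
  + by move=> k; have [] := qP (phi k).
- have /= := sequential_closed (@closed_normr_le R n G) _ sphi; apply => k.
  have [qM Oq _ _] := qP (phi k).
  by have [] := hG (q (phi k)).2; first by exists (q (phi k)).1.
- have : (fun k => 2 * e (phi k) + dot (q (phi k)).2.2 d) @ \oo
      --> 2 * 0 + dot s d.
    apply: cvgD; first by apply: cvgM; [exact: cvg_cst|exact: (cvg_subsequence kphi)].
    by apply: cvg_dot => //; exact: cvg_cst.
  rewrite mulr0 add0r => hl.
  apply: (@closed_cvg _ _ \oo _ _ _ (@closed_ge _ 0) _ _ hl).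
  exists 0%N => // k _ /=; have [_ _ _] := qP (phi k); lra.
Unshelve. all: by end_near. Qed.

Lemma tangent_envelope W r y (del : R) u : working_set W ->
  tangent_solution N C x Q W r y -> f x - model2 x Q W y <= del ->
  C u -> N (u - x) <= r ->
  f x - del <= envelope u + 2^-1 * dot (u - x) (Q *m (u - x)).
Proof.
move=> wW [_ ymin] hdel Cu ur; have := ymin u (conj Cu ur).
have := model1_le_envelope wW Cu; rewrite /model2 in hdel *; lra.
Qed.

(** The scale [r'] is kept apart from the radius [r] because a run may have an eventually constant
    radius. A displacement of length at most [r'] into [C] is feasible and has a quadratic term of
    order [r'^2], so the envelope falls below [f x] by only [o(r')]. *)
Lemma stationary_of_tangent : closed C -> convex_set C ->
  (forall eta : R, 0 < eta -> exists W r y r',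
     [/\ working_set W, tangent_solution N C x Q W r y, 0 < r' < eta, r' <= r &
         f x - model2 x Q W y <= eta * r']) ->
  [set s + v | s in clarke_subdiff f x & v in normal_cone C x] 0.
Proof.
move=> cC convC small; have [G hG] := oracle_planes_bounded.
have descent u : C u ->
    exists2 s, clarke_subdiff f x s /\ `|s| <= G & 0 <= dot s (u - x).
  move=> Cu; set d := u - x; apply: envelope_subgradient => // e e0.
  pose D := 1 + N d; pose q := `|dot d (Q *m d)|.
  have D0 : 1 <= D by rewrite lerDl (is_norm_ge0 hN).
  have q0 : 0 <= q by exact: normr_ge0.
  have Dq0 : 0 < D + q by lra.
  (* The three bounds serve, in turn, to keep [t <= 1], to get [t < e], and to absorb into [e * t]
     both the tangent gap [eta * r' = t * eta * D] and the quadratic term, at most [t * eta * q]. *)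
  pose eta := Num.min 1 (Num.min e (e / (D + q))).
  have eta0 : 0 < eta by rewrite !lt_min ltr01 e0 divr_gt0.
  have eta1 : eta <= 1 by rewrite ge_min lexx.
  have etae : eta <= e by rewrite !ge_min lexx !orbT.
  have etaD : eta * (D + q) <= e by rewrite -ler_pdivlMr// !ge_min lexx !orbT.
  have [W [r [y [r' [wW ty /andP[r'0 r'eta] r'r hdel]]]]] := small _ eta0.
  pose t := r' / D; have t0 : 0 < t by rewrite divr_gt0// (lt_le_trans ltr01).
  have tD : t * D = r' by rewrite divfK// gt_eqF// (lt_le_trans ltr01).
  have tr' : t <= r' by rewrite -tD ler_peMr// ltW.
  have Ct : C (x + t *: d) by move/convex_setP : convC; apply => //; lra.
  exists t; split => //; first by lra.
  have := tangent_envelope wW ty hdel Ct.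
  rewrite addrAC subrr add0r (is_normZ hN) gtr0_norm// => /(_ _).
  have Ntd : t * N d <= r by rewrite /D in tD; nra.
  move=> /(_ Ntd); rewrite -scalemxAr dotZl dotZr.
  have := ler_norm (dot d (Q *m d)); rewrite -/q => qle.
  have : t * (t * dot d (Q *m d)) <= t * (eta * q).
    rewrite ler_wpM2l ?(ltW t0)//; apply: (@le_trans _ _ (t * q)).
      by rewrite ler_wpM2l ?(ltW t0).
    by rewrite ler_wpM2r//; lra.
  have : t * (eta * (D + q)) <= t * e by rewrite ler_wpM2l ?(ltW t0).
  rewrite -tD.
  have : 0 <= t * (eta * q) by rewrite mulr_ge0 ?(ltW t0)// mulr_ge0 ?(ltW eta0).
  lra.
(* Truncation at [G] makes the set of candidate subgradients bounded, as the minimax argument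
   requires. *)
pose K := [set s | clarke_subdiff f x s /\ `|s| <= G].
have cK : closed K.
  by apply: closedI; [exact: clarke_subdiff_closed|exact: closed_normr_le].
have convK : convex_set K.
  apply/convex_setP => u v t [cu uG] [cv vG] t0 t1; split.
    by have /convex_setP := @clarke_subdiff_convex R n f x; exact.
  have -> : u + t *: (v - u) = (1 - t) *: u + t *: v.
    by apply/matrixP => i j; rewrite !mxE; ring.
  apply: le_trans (ler_normD _ _) _; rewrite !normrZ !ger0_norm ?subr_ge0//.
  by nra.
have [s0 Ks0 _] := descent x hx.
have [|s [cs _] sP] := @convex_minimax R n K C x G cK convK
  (ex_intro _ s0 Ks0) _ cC convC hx descent.
  by move=> s [].
exists s => //; exists (- s); last by rewrite subrr.
by split=> // u Cu; rewrite dotNl oppr_le0; exact: sP.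
Qed.

End Criterion.

(** Drops larger than [eta] at every index from [K] on would make [D] negative after about
    [D K / eta] steps. *)
Lemma slow_decrease (R : realType) (D : nat -> R) (K : nat) (eta : R) :
  0 < eta -> (forall k, 0 <= D k) ->
  exists2 k, (K <= k)%N & D k - D k.+1 <= eta.
Proof.
move=> eta0 D0; apply: contrapT => h.
have dec m : D (K + m)%N <= D K - m%:R * eta.
  elim: m => [|m IH]; first by rewrite addn0 mul0r subr0.
  have : ~ (D (K + m)%N - D (K + m).+1 <= eta).
    by move=> le; apply: h; exists (K + m)%N => //; exact: leq_addr.
  by move/negP; rewrite -ltNge addnS -natr1; lra.
pose m := (Num.truncn (D K / eta)).+1.
have : D K / eta < m%:R by exact: truncnS_gt.
by rewrite ltr_pdivrMr// => lt; have := dec m; have := D0 (K + m)%N; lra.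
Qed.

(** * Analysis of an infinite run: turns that halve the radius and turns that keep it *)

Section Loop.
Context {R : realType} {n : nat}.
Local Notation V := 'cV[R]_n.
Variables (N : V -> R) (hN : is_norm N) (M : R) (hM : 0 < M) (f : V -> R).
Variables (O : V -> V -> set (R * V)) (hO : cutting_plane_oracle N M f O).
Variables (C : set V) (x : V) (hx : C x) (Q : 'M[R]_n).
Hypotheses (hQsym : symmetric_mx Q) (hQpos : posdef_mx Q).
Variables (gamma gammat theta bigTheta : R).
Hypotheses (hgamma : 0 < gamma) (hgammat : gamma < gammat).
Hypotheses (hgammat1 : gammat < 1).
Hypotheses (htheta : 0 < theta) (htheta1 : theta < 1) (hbigTheta : 1 <= bigTheta).

Local Notation working := (working_set N M f O C x).
Local Notation gap W y := (f x - model2 x Q W y).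

Lemma quadratic_ge0 u : 0 <= dot u (Q *m u).
Proof.
have [->|u0] := eqVneq u 0; first by rewrite dot0l.
exact: ltW (hQpos u0).
Qed.

Lemma model1_le_model2 W u : model1 x W u <= model2 x Q W u.
Proof. by rewrite lerDl mulr_ge0// quadratic_ge0. Qed.

Lemma tangent_gap_ge0 W r y : working W -> 0 < r ->
  tangent_solution N C x Q W r y -> 0 <= gap W y.
Proof.
move=> wW r0 [_ /(_ x)]; rewrite (model2_base hN hM hO hx) // subr_ge0; apply.
by split=> //; rewrite /cball /= subrr (is_norm0 hN) ltW.
Qed.

(** The point [t] stands for [z] or, after the fall-back, for [y], so that both ways of halving the
    radius are treated together. *)
Definition reducing_turn W (r : R) y g W' (r' : R) t : Prop :=
  [/\ trial_step N f C theta bigTheta x Q W y t, rho f x Q W t < gamma,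
      null_step_set f O x W y g t W', gammat <= rhot f x Q W W' t &
      N (t - x) <= M /\ r' = r / 2].

Definition keeping_turn W (r : R) y g W' (r' : R) : Prop :=
  [/\ N (y - x) <= M, null_step_set f O x W y g y W',
      rhot f x Q W W' y < gammat & r' = r].

(** The fall-back rule ensures that a turn keeping the radius has used [y]. If [y] halves it, [y] is
    a legitimate trial step because the gap is nonnegative, [theta < 1] and [1 <= bigTheta]. *)
Lemma rejected_turn_cases W r y g z W' r' : working W -> 0 < r ->
  rejected_turn N M f C O gamma gammat theta bigTheta x Q W r y g z W' r' ->
  (exists t, reducing_turn W r y g W' r' t) \/ keeping_turn W r y g W' r'.
Proof.
move=> wW r0 [ty ag tz [rz zM] [Wz nz [[rt -> ->]|[_ ry yM ny ->]]]].
  by left; exists z.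
rewrite /next_radius; case: ltP => rt; first by right.
left; exists y; split => //; have D0 := tangent_gap_ge0 wW r0 ty.
split; first by case: ty => -[].
  by rewrite ler_piMl// ltW.
by rewrite ler_peMl// is_norm_ge0.
Qed.

(** Subtracting the failed acceptance test from [gammat <= rhot] bounds [(gammat - gamma) * gap W t]
    by [f t - model1 x W' t]. The plane [p] belongs to [W'], so this difference is at most
    [e * N (t - x)]. *)
Lemma reducing_turn_gap W r y g W' r' t (p : R * V) (e : R) :
  working W -> working W' -> 0 < r -> tangent_solution N C x Q W r y ->
  reducing_turn W r y g W' r' t ->
  0 <= e -> O t x p -> f t <= plane_eval x p t + e * N (t - x) ->
  theta * (gammat - gamma) * gap W y <= e * bigTheta * r.
Proof.
move=> wW wW' r0 ty [[Ct decr tle] rt [_ _ OW' _] rtt _] e0 Op ft.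
have D0 := tangent_gap_ge0 wW r0 ty.
have tD0 : 0 <= theta * gap W y by rewrite mulr_ge0// ltW.
(* With a vanishing denominator [rhot] would be 0, below [gammat]. *)
have Dt : 0 < gap W t.
  rewrite lt_neqAle (le_trans tD0 decr) andbT eq_sym; apply/eqP => Dt0.
  by move: rtt; rewrite /rhot Dt0 invr0 mulr0 leNgt (lt_trans hgamma hgammat).
move: rt rtt; rewrite /rho /rhot ltr_pdivrMr// ler_pdivlMr// => rt rtt.
have pW' : plane_eval x p t <= model1 x W' t.
  by apply: plane_eval_le_model1; [exact: working_bounded wW'|exact: OW'].
have yr : N (y - x) <= r by case: ty => -[].
have : (gammat - gamma) * (theta * gap W y) <= (gammat - gamma) * gap W t.
  by rewrite ler_wpM2l// subr_ge0 ltW.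
have : e * N (t - x) <= e * (bigTheta * r).
  rewrite ler_wpM2l//; apply: le_trans tle _; rewrite ler_wpM2l//.
  exact: le_trans ler01 hbigTheta.
by lra.
Qed.

(** Expand the aggregate plane plus the quadratic term around [y]: the linear part has slope [- v],
    which pairs nonnegatively with [y' - y] since [v] is normal to the ball at [y]. *)
Lemma aggregate_growth W r y g W' y' : bounded_planes W' ->
  aggregate_subgradient N C x Q W r y g -> W' (aggregate_plane x W y g) ->
  N (y' - x) <= r ->
  model2 x Q W y + 2^-1 * dot (y' - y) (Q *m (y' - y)) <= model2 x Q W' y'.
Proof.
move=> bW' [_ [v [_ vN] gv]] W'ag y'r.
have := plane_eval_le_model1 x y' bW' W'ag; rewrite plane_eval_aggregate.
have := vN y' y'r.
have -> : v = - (g + Q *m (y - x)).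
  by apply/eqP; rewrite -addr_eq0 addrC; apply/eqP.
rewrite /model2; have -> : y' - x = (y - x) + (y' - y).
  by rewrite [RHS]addrC addrA subrK.
move: (y - x) (y' - y) => a b.
rewrite mulmxDr !dotDr !dotDl dotNl dotDl (dot_symmetric b a hQsym).
by rewrite (dotC (Q *m a) b) -(dot_symmetric a b hQsym); lra.
Qed.

(* The plane nearly attaining [model1 W'] at [y] lies above [W] there, so it is
   an oracle plane; unlike aggregate planes, these have bounded slopes. *)
Lemma keeping_turn_gap W r y g W' r' y' (G : R) :
  working W -> working W' -> 0 <= gap W y -> gap W' y' <= gap W y ->
  (forall p, oracle_planes N M O x p -> `|p.2| <= G) ->
  keeping_turn W r y g W' r' ->
  gap W' y' <= gammat * gap W y + n%:R * G * `|y' - y|.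
Proof.
move=> wW wW' D0 DD' hG [yM [_ _ _ W'W] rt _].
have G0 : 0 <= G.
  have [p /hG] := oracle_planes_neq0 hN hM hO x.
  exact: le_trans (normr_ge0 _).
have e0 : 0 <= n%:R * G * `|y' - y| by rewrite !mulr_ge0.
(* A zero gap is treated apart: [rhot] then has its default value and says nothing about [W']. *)
have [Dy|Dy] := eqVneq (gap W y) 0; first by move: DD'; rewrite Dy; lra.
have {Dy}Dy0 : 0 < gap W y by rewrite lt_neqAle eq_sym Dy.
move: rt; rewrite /rhot ltr_pdivrMr// => rt.
have := model1_le_model2 W y; set b := model1 x W y => b2.
have gD : gammat * gap W y < gap W y by rewrite gtr_pMl.
(* This slack yields a plane above [f x - gammat * gap W y] at [y], a level that exceeds
   [model2 x Q W y] because [gammat < 1], hence also [model1 x W y]. *)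
have eps0 : 0 < model1 x W' y - (f x - gammat * gap W y) by lra.
have [p W'p] := model1_adherent x y (working_neq0 wW') (working_bounded wW') eps0.
rewrite subKr => py.
have Pp : oracle_planes N M O x p.
  case: (W'W p W'p) => [[[Wp|Ep]|ap]|Op].
  - have := plane_eval_le_model1 x y (working_bounded wW) Wp; rewrite -/b; lra.
  - exact: (exactness_planes_oracle hN hM Ep).
  - by move: py; rewrite ap plane_eval_aggregate subrr dot0r addr0 -/b; lra.
  - by exists y.
have := plane_eval_le_model1 x y' (working_bounded wW') W'p.
have := model1_le_model2 W' y'.
have -> : plane_eval x p y' = plane_eval x p y + dot p.2 (y' - y).
  by rewrite /plane_eval !dotBr; ring.
have : - dot p.2 (y' - y) <= n%:R * G * `|y' - y|.
  apply: le_trans (ler_norm _) _; rewrite normrN.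
  apply: le_trans (normr_dot _ _) _.
  by rewrite ler_wpM2r// ler_wpM2l// hG.
by lra.
Qed.

Variables (W : nat -> set (R * V)) (r : nat -> R) (y g z : nat -> V).
Hypothesis hloop :
  infinite_inner_loop N M f C O gamma gammat theta bigTheta x Q W r y g z.

Lemma loop_working k : working (W k) /\ 0 < r k.
Proof.
elim: k => [|k [wW r0]].
  split; last exact: loop_init_radius hloop.
  apply: oracle_working => //; last exact: loop_init_exact hloop.
  by move=> p /(loop_init_planes hloop)[z0]; exists z0.
have turn := loop_turn hloop k; have [_ ag _ _ _] := turn.
have [[t [_ _ nt _ [tM ->]]]|[yM ny _ ->]] := rejected_turn_cases wW r0 turn.
  by split; [exact: null_step_working wW tM ag nt|rewrite divr_gt0].
by split; first exact: null_step_working wW yM ag ny.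
Qed.

Local Notation keeps k := (keeping_turn (W k) (r k) (y k) (g k) (W k.+1)
  (r k.+1)).
Local Notation reduces k :=
  (reducing_turn (W k) (r k) (y k) (g k) (W k.+1) (r k.+1)).

Lemma loop_cases k : (exists t, reduces k t) \/ keeps k.
Proof.
by have [wW r0] := loop_working k; exact: rejected_turn_cases wW r0 (loop_turn hloop k).
Qed.

Lemma loop_tangent k : tangent_solution N C x Q (W k) (r k) (y k).
Proof. by have [] := loop_turn hloop k. Qed.

Lemma loop_gap_ge0 k : 0 <= gap (W k) (y k).
Proof.
by have [wW r0] := loop_working k; exact: tangent_gap_ge0 wW r0 (loop_tangent k).
Qed.

(** At an index where the gap drops by at most [eta], growth forces a step of length at most [b],
    and the contraction estimate then bounds [(1 - gammat) * gap] by [eta + n * G * b]. *)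
Lemma eventually_keeping_gap (K : nat) : (forall k, (K <= k)%N -> keeps k) ->
  forall del : R, 0 < del -> exists2 k, (K <= k)%N & gap (W k) (y k) <= del.
Proof.
move=> hK del del0.
have [G hG] := oracle_planes_bounded hN hM hO x.
have G0 : 0 <= G.
  have [p /hG[_]] := oracle_planes_neq0 hN hM hO x.
  exact: le_trans (normr_ge0 _).
have [c c0 cQ] := posdef_ge hQpos.
have nG0 : 0 <= n%:R * G by rewrite mulr_ge0.
have g1 : 0 < 1 - gammat by rewrite subr_gt0.
(* Chosen so that [n * G * b] is at most half of [(1 - gammat) * del]; the added 1 guards against
   [n * G = 0]. The other half goes to [eta], whose second bound turns a small drop into a step of
   length at most [b]. *)
pose b := (1 - gammat) * del / (2 * (n%:R * G + 1)).
have den0 : 0 < 2 * (n%:R * G + 1) by lra.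
have b0 : 0 < b by rewrite divr_gt0// mulr_gt0.
have bE : b * (2 * (n%:R * G + 1)) = (1 - gammat) * del.
  by rewrite divfK// gt_eqF.
pose eta := Num.min ((1 - gammat) * del / 2) (c * b ^+ 2 / 2).
have eta0 : 0 < eta.
  rewrite lt_min; apply/andP; split; apply: divr_gt0 => //;
    by apply: mulr_gt0 => //; exact: exprn_gt0.
have [k Kk dk] := slow_decrease K eta0 loop_gap_ge0.
exists k => //; have kk := hK k Kk.
have [yM nk _ rk] := kk; have [_ ag _ _ _] := loop_turn hloop k.
have [wW _] := loop_working k; have [wW' _] := loop_working k.+1.
have [[_ y'r] _] := loop_tangent k.+1.
have agW' : W k.+1 (aggregate_plane x (W k) (y k) (g k)) by case: nk.
have growth : model2 x Q (W k) (y k)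
    + 2^-1 * dot (y k.+1 - y k) (Q *m (y k.+1 - y k))
    <= model2 x Q (W k.+1) (y k.+1).
  (* The radius is unchanged, so the next tangent solution lies in the ball to which the normal
     vector at [y k] refers. *)
  by apply: (aggregate_growth (working_bounded wW') ag agW'); rewrite -rk.
have qge := cQ (y k.+1 - y k).
have q0 := quadratic_ge0 (y k.+1 - y k).
have dgap : gap (W k.+1) (y k.+1) <= gap (W k) (y k) by lra.
have := keeping_turn_gap wW wW' (loop_gap_ge0 k) dgap
  (fun p Pp => proj2 (hG p Pp)) kk.
have eta1 : eta <= (1 - gammat) * del / 2 by rewrite ge_min lexx.
have eta2 : eta <= c * b ^+ 2 / 2 by rewrite ge_min lexx orbT.
have step : `|y k.+1 - y k| <= b.
  rewrite -ler_sqr ?nnegrE ?(ltW b0)// -(ler_pM2l c0).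
  lra.
have := ler_wpM2l nG0 step.
move=> h1 h2; rewrite -(ler_pM2l g1).
lra.
Qed.

Lemma loop_radius_le k l : (k <= l)%N -> r l <= r k.
Proof.
elim: l => [|l IH]; first by rewrite leqn0 => /eqP->.
rewrite leq_eqVlt => /predU1P[->//|/IH]; apply: le_trans.
have [_ r0] := loop_working l.
by have [[t [_ _ _ _ [_ ->]]]|[_ _ _ ->]] := loop_cases l; lra.
Qed.

(** Halving a radius of at most [r 0 / (m+1)] brings it to at most [r 0 / (m+2)]; this harmonic rate
    is enough for convergence to 0. *)
Lemma infinitely_reducing_radius :
  (forall K, exists2 k, (K <= k)%N & exists t, reduces k t) ->
  forall m : nat, exists k, r k <= r 0%N * m.+1%:R^-1 /\ exists t, reduces k t.
Proof.
move=> hred; elim=> [|m [k [rk [t redk]]]].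
  by have [k _ redk] := hred 0%N; exists k; rewrite invr1 mulr1 loop_radius_le.
(* Starting from [k.+1] makes the halving at [k] count in [r l]. *)
have [l kl redl] := hred k.+1; exists l; split => //.
apply: le_trans (loop_radius_le kl) _.
have [_ _ _ _ [_ ->]] := redk; have [_ r0] := loop_working 0%N.
rewrite ler_pdivrMr//; apply: le_trans rk _.
rewrite -mulrA ler_pM2l// mulrC ler_pdivlMr ?ltr0n//.
rewrite mulrC ler_pdivrMr ?ltr0n// -natrM ler_nat.
by rewrite mul2n -addnn addnS ltnS leq_addr.
Qed.

Lemma infinitely_reducing_gap :
  (forall K, exists2 k, (K <= k)%N & exists t, reduces k t) ->
  forall eta : R, 0 < eta -> exists2 k, r k < eta & gap (W k) (y k) <= eta * r k.
Proof.
move=> /infinitely_reducing_radius hred eta eta0.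
have [k hk] := choice hred.
have [t ht] := choice (fun m => proj2 (hk m)).
have T0 : 0 < bigTheta := lt_le_trans ltr01 hbigTheta.
have [c c0 cN] := is_norm_ge hN.
have rk0 m : 0 < r (k m) by have [] := loop_working (k m).
have rk : r \o k @ \oo --> (0 : R).
  apply: (@squeeze_cvgr _ _ _ _ (fun=> 0) (fun m => r 0%N * m.+1%:R^-1)).
  - by near=> m; rewrite /= ltW//; case: (hk m).
  - exact: cvg_cst.
  - rewrite -[X in _ --> X](mulr0 (r 0%N)); apply: cvgM; first exact: cvg_cst.
    exact: cvg_harmonic.
(* The trial points lie within [bigTheta] times the vanishing radius of [x], so (O3) applies along
   them. *)
have tx : t @ \oo --> x.
  apply/cvgrPdist_le => e e0; near=> m.
  rewrite distrC -(ler_pM2l c0); apply: le_trans (cN _) _.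
  have [[_ _ tle] _ _ _ _] := ht m; apply: le_trans tle _.
  have [[_ yr] _] := loop_tangent (k m).
  apply: (@le_trans _ _ (bigTheta * r (k m))); first by rewrite ler_pM2l.
  rewrite -ler_pdivlMl// ltW//; near: m; apply: cvgr_lt rk _ _.
  by rewrite mulr_gt0 ?invr_gt0// mulr_gt0.
have [a_ [g_ [e_ [Oj epos e_0 fle]]]] := oracle_O3 hO tx.
have th0 : 0 < theta * (gammat - gamma) by rewrite mulr_gt0// subr_gt0.
have [m [em rm]] : exists m,
    e_ m * bigTheta <= theta * (gammat - gamma) * eta /\ r (k m) < eta.
  near \oo => m; exists m; split.
    rewrite -ler_pdivlMr// ltW//; near: m; apply: cvgr_lt e_0 _ _.
    by rewrite divr_gt0 // mulr_gt0.
  by near: m; exact: cvgr_lt rk _ eta0.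
exists (k m) => //.
have [wW r0] := loop_working (k m); have [wW' _] := loop_working (k m).+1.
have := reducing_turn_gap wW wW' r0 (loop_tangent _) (ht m) (ltW (epos m))
  (Oj m) (fle m).
move=> h; rewrite -(ler_pM2l th0); apply: le_trans h _.
by rewrite mulrA ler_wpM2r// ltW.
Unshelve. all: by end_near. Qed.

Lemma loop_tangent_small (eta : R) : 0 < eta -> exists W r y r',
  [/\ working W, tangent_solution N C x Q W r y, 0 < r' < eta, r' <= r &
      gap W y <= eta * r'].
Proof.
move=> eta0.
have [[K hK]|hred] := pselect (exists K, forall k, (K <= k)%N -> keeps k).
  have [_ rK0] := loop_working K.
  have rE k : (K <= k)%N -> r k = r K.
    elim: k => [|k IH]; first by rewrite leqn0 => /eqP ->.
    rewrite leq_eqVlt => /predU1P[<-//|Kk].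
    by have [_ _ _ ->] := hK k Kk; exact: IH.
  (* The scale may not exceed the constant radius; [eta / 2] makes [r' < eta] strict. The gap is
     then pushed below [eta * r'] by going far enough in the run. *)
  pose r' := Num.min (r K) (eta / 2).
  have r'0 : 0 < r' by rewrite lt_min rK0 divr_gt0.
  have [k Kk gk] := eventually_keeping_gap hK (mulr_gt0 eta0 r'0).
  exists (W k), (r k), (y k), r'; split => //.
  - by have [] := loop_working k.
  - exact: loop_tangent.
  - rewrite r'0 (@le_lt_trans _ _ (eta / 2)) ?ge_min ?lexx ?orbT//; lra.
  - by rewrite rE// ge_min lexx.
have [|k rk gk] := infinitely_reducing_gap _ eta0.
  move=> K; apply: contrapT => noK; apply: hred; exists K => k Kk.
  have [redk|//] := loop_cases k.
  by exfalso; apply: noK; exists k.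
have [wW r0] := loop_working k.
by exists (W k), (r k), (y k), (r k); split; rewrite ?r0 ?rk//; exact: loop_tangent.
Qed.

End Loop.

Theorem lemma5p8 (R : realType) (n : nat)
    (N : 'cV[R]_n -> R) (hN : is_norm N)
    (f : 'cV[R]_n -> R) (hf : locally_lipschitz f)
    (C : set 'cV[R]_n) (hCclosed : closed C) (hCconvex : convex_set C)
    (M : R) (hM : 0 < M)
    (O : 'cV[R]_n -> 'cV[R]_n -> set (R * 'cV[R]_n))
    (hO : cutting_plane_oracle N M f O)
    (gamma gammat theta bigTheta q : R)
    (hgamma : 0 < gamma) (hgammat : gamma < gammat) (hgammat1 : gammat < 1)
    (htheta : 0 < theta) (htheta1 : theta < 1) (hbigTheta : 1 <= bigTheta)
    (hq : 0 < q)
    (x : 'cV[R]_n) (hx : C x)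
    (Q : 'M[R]_n) (hQsym : symmetric_mx Q) (hQpos : posdef_mx Q)
    (hQq : opnorm N Q <= q)
    (W : nat -> set (R * 'cV[R]_n)) (r : nat -> R) (y g z : nat -> 'cV[R]_n)
    (hloop : infinite_inner_loop N M f C O gamma gammat theta bigTheta x Q
               W r y g z) :
  [set s + v | s in clarke_subdiff f x & v in normal_cone C x] 0.
Proof.
apply: (stationary_of_tangent (O := O) (Q := Q) hN hM hO hx hCclosed
  hCconvex) => eta eta0.
exact: (loop_tangent_small hN hM hO hx hQsym hQpos hgamma hgammat hgammat1
  htheta htheta1 hbigTheta hloop eta0).
Qed.
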